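(* Let $M$ be a submanifold of a Sasakian manifold, tangent to $\xi$. For all tangent vector fields $X,Y$ on $M$, $$(\bar\nabla_XF)Y=f\,h(X,Y)-h(X,PY).$$ Hence $F$ is parallel if and only if $h(X,PY)=f\,h(X,Y)$ for all $X,Y\in\Gamma(TM)$.
   Context: A Sasakian manifold $(\overline M^{2m+1},\phi,\xi,\eta,g)$ consists of a Riemannian metric $g$ with Levi-Civita connection $\widetilde\nabla$, a $(1,1)$-tensor field $\phi$, a vector field $\xi$ (the Reeb field) and a 1-form $\eta$ with $\phi^2X=-X+\eta(X)\xi$, $\eta(\xi)=1$, $\phi\xi=0$, $g(\phi X,\phi Y)=g(X,Y)-\eta(X)\eta(Y)$ and $(\widetilde\nabla_X\phi)Y=g(X,Y)\xi-\eta(Y)X$. Let $M$ be an immersed submanifold with $\xi\in\Gamma(TM)$, induced Levi-Civita connection $\nabla$, second fundamental form $h$ and normal connection $\nabla^\perp$. For $X\in TM$ and $V\in T^\perp M$ write $\phi X=PX+FX$ and $\phi V=tV+fV$ with $PX,tV$ tangent and $FX,fV$ normal. Define $(\bar\nabla_XF)Y=\nabla^\perp_X(FY)-F\nabla_XY$; $F$ is parallel if $\bar\nabla F=0$. *)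

(* Defs.v *)
(** Submanifolds of Sasakian manifolds, over an arbitrary [realType] *)
From HB Require Import structures.
From mathcomp Require Import all_boot all_order all_algebra.
From mathcomp Require Import all_classical all_reals all_analysis.
Import Order.TTheory GRing.Theory Num.Theory.
Import numFieldNormedType.Exports.

Set Implicit Arguments.
Unset Strict Implicit.
Unset Printing Implicit Defensive.

Local Open Scope classical_set_scope.
Local Open Scope ring_scope.

(** * Smooth manifolds *)

(** Every iterated partial derivative of [f] is (Frechet) differentiable at [z].
    Only used for all [z] in an open set, where it is the C^oo property. *)
Definition smooth_pt (R : realType) (n : nat) (W : normedModType R)
    (f : 'rV[R]_n -> W) (z : 'rV[R]_n) : Prop :=
  forall s : seq 'I_n,
    differentiable
      (foldr (fun (i : 'I_n) (g : 'rV[R]_n -> W) (x : 'rV[R]_n) =>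
                'D_(delta_mx 0 i) g x) f s) z.

(** The atlas is indexed by the points of the manifold: it has one chosen chart
    [chart p] around each point [p] (charts may be repeated, so this only
    selects a subatlas of the maximal one).  [chart_inv p] matters only on the
    image of [chart p]. *)
Record manifold (R : realType) (n : nat) := Manifold {
  carrier :> topologicalType;
  chart_dom : carrier -> set carrier;
  chart : carrier -> carrier -> 'rV[R]_n;
  chart_inv : carrier -> 'rV[R]_n -> carrier;
  manifold_hausdorff : hausdorff_space carrier;
  manifold_countable : @second_countable carrier;
  chart_dom_open : forall p, open (chart_dom p);
  chart_dom_center : forall p, chart_dom p p;
  chart_image_open : forall p, open (chart p @` chart_dom p);
  chartK : forall p q, chart_dom p q -> chart_inv p (chart p q) = q;
  chart_continuous : forall p q,
    chart_dom p q -> {for q, continuous (chart p)};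
  chart_inv_continuous : forall p q,
    chart_dom p q -> {for chart p q, continuous (chart_inv p)};
  chart_transition : forall p q r, chart_dom p r -> chart_dom q r ->
    smooth_pt (chart q \o chart_inv p) (chart p r) }.

(** The tangent space at [p] is ['rV_n], a tangent vector being represented by
    its components in [chart p].  A vector field is thus a map [M -> 'rV_n],
    whose value at [r] is written in [chart r]; [to_chart p r] gives the
    components in [chart p] of a vector tangent at [r].
    Row vectors, hence linear maps act on the right. *)
Section Manifold.
Context {R : realType} {n : nat} {M : manifold R n}.
Implicit Types (p r : M) (v : 'rV[R]_n) (X Y : M -> 'rV[R]_n).

Definition to_chart p r v : 'rV[R]_n :=
  v *m jacobian (chart p \o chart_inv r) (chart r r).

(** The [j]-th coordinate vector field of [chart p]; meaningful on
    [chart_dom p]. *)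
Definition frame p (j : 'I_n) : M -> 'rV[R]_n := fun r =>
  delta_mx 0 j *m jacobian (chart r \o chart_inv p) (chart p r).

(** C^oo on a neighbourhood of [p] *)
Definition smooth_near (W : normedModType R) p (u : M -> W) : Prop :=
  \forall z \near chart p p, smooth_pt (u \o chart_inv p) z.

Definition vf_smooth_near p X : Prop :=
  smooth_near p (fun r => to_chart p r (X r)).

(** [X \in \Gamma(TM)] *)
Definition smooth_vf X : Prop := forall p, vf_smooth_near p X.

(** The derivative at [p] of [u] along the tangent vector [v] *)
Definition dir_deriv (W : normedModType R) p v (u : M -> W) : W :=
  'D_v (u \o chart_inv p) (chart p p).

End Manifold.

(** * Metrics and connections *)

Section Riemannian.
Context {R : realType} {n : nat} {M : manifold R n}.
Implicit Types (p r : M) (g : M -> 'M[R]_n).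

Definition inner g p (v w : 'rV[R]_n) : R := (v *m g p *m w^T) 0 0.

Record riemannian_metric g : Prop := {
  metric_sym : forall p v w, inner g p v w = inner g p w v;
  metric_pos : forall p v, v != 0 -> 0 < inner g p v v;
  metric_smooth : forall p (X Y : M -> 'rV[R]_n),
    vf_smooth_near p X -> vf_smooth_near p Y ->
    smooth_near p (fun r => inner g r (X r) (Y r)) }.

(** [nabla p v Y] is the covariant derivative at [p] of the field [Y] along
    [v].  As connections are local operators, it is applied to all fields that
    are smooth on some neighbourhood of [p], and is arbitrary on other fields.
    Locality follows from the Leibniz rule, [f] being a locally constant
    function. *)
Record connection (nabla : M -> 'rV[R]_n -> (M -> 'rV[R]_n) -> 'rV[R]_n)
    : Prop := {
  conn_linear : forall p (a : R) v w Y, vf_smooth_near p Y ->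
    nabla p (a *: v + w) Y = a *: nabla p v Y + nabla p w Y;
  conn_add : forall p v Y Z, vf_smooth_near p Y -> vf_smooth_near p Z ->
    nabla p v (fun r => Y r + Z r) = nabla p v Y + nabla p v Z;
  conn_leibniz : forall p v (f : M -> R) Y,
    smooth_near p f -> vf_smooth_near p Y ->
    nabla p v (fun r => f r *: Y r)
      = dir_deriv p v f *: Y p + f p *: nabla p v Y;
  conn_smooth : forall p X Y, vf_smooth_near p X -> vf_smooth_near p Y ->
    vf_smooth_near p (fun r => nabla r (X r) Y) }.

(** Torsion is expressed through the action of vector fields on functions:
    [(nabla_X Y - nabla_Y X) u = X (Y u) - Y (X u) = [X, Y] u]. *)
Record levi_civita g nabla : Prop := {
  lc_connection : connection nabla;
  lc_torsion_free : forall p X Y (u : M -> R),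
    vf_smooth_near p X -> vf_smooth_near p Y -> smooth_near p u ->
    dir_deriv p (nabla p (X p) Y - nabla p (Y p) X) u
      = dir_deriv p (X p) (fun r => dir_deriv r (Y r) u)
        - dir_deriv p (Y p) (fun r => dir_deriv r (X r) u);
  lc_metric : forall p v Y Z, vf_smooth_near p Y -> vf_smooth_near p Z ->
    dir_deriv p v (fun r => inner g r (Y r) (Z r))
      = inner g p (nabla p v Y) (Z p) + inner g p (Y p) (nabla p v Z) }.

End Riemannian.

(** * Sasakian manifolds *)

(** [phi], acting on row vectors on the right, sends [v] at [p] to
    [v *m phi p], and [eta] sends it to [(v *m eta p) 0 0]. *)
Record sasakian (R : realType) (m : nat) := Sasakian {
  sas_manifold :> manifold R (2 * m).+1;
  sas_g : sas_manifold -> 'M[R]_((2 * m).+1);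
  sas_phi : sas_manifold -> 'M[R]_((2 * m).+1);
  sas_xi : sas_manifold -> 'rV[R]_((2 * m).+1);
  sas_eta : sas_manifold -> 'cV[R]_((2 * m).+1);
  sas_nabla : sas_manifold -> 'rV[R]_((2 * m).+1) ->
    (sas_manifold -> 'rV[R]_((2 * m).+1)) -> 'rV[R]_((2 * m).+1);
  sas_metric : riemannian_metric sas_g;
  sas_levi_civita : levi_civita sas_g sas_nabla;
  sas_phi_smooth : forall p X, vf_smooth_near p X ->
    vf_smooth_near p (fun r => X r *m sas_phi r);
  sas_xi_smooth : smooth_vf sas_xi;
  sas_eta_smooth : forall p X, vf_smooth_near p X ->
    smooth_near p (fun r => (X r *m sas_eta r) 0 0);
  sas_phi2 : forall p (v : 'rV[R]_((2 * m).+1)),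
    v *m sas_phi p *m sas_phi p = - v + (v *m sas_eta p) 0 0 *: sas_xi p;
  sas_eta_xi : forall p, (sas_xi p *m sas_eta p) 0 0 = 1;
  sas_phi_xi : forall p, sas_xi p *m sas_phi p = 0;
  sas_g_phi : forall p (v w : 'rV[R]_((2 * m).+1)),
    inner sas_g p (v *m sas_phi p) (w *m sas_phi p)
      = inner sas_g p v w - (v *m sas_eta p) 0 0 * (w *m sas_eta p) 0 0;
  sas_nabla_phi : forall p (v : 'rV[R]_((2 * m).+1)) Y, vf_smooth_near p Y ->
    sas_nabla p v (fun r => Y r *m sas_phi r) - sas_nabla p v Y *m sas_phi p
      = inner sas_g p v (Y p) *: sas_xi p - (Y p *m sas_eta p) 0 0 *: v }.

(** * Immersed submanifolds *)

Section Immersion.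
Context {R : realType} {n N : nat} {M : manifold R n} {Mbar : manifold R N}.
Variable iota : M -> Mbar.

Definition smooth_map : Prop :=
  continuous iota /\
  forall p, \forall z \near chart p p,
    smooth_pt (chart (iota p) \o iota \o chart_inv p) z.

Definition diff_map (p : M) : 'M[R]_(n, N) :=
  jacobian (chart (iota p) \o iota \o chart_inv p) (chart p p).

Definition immersion : Prop := smooth_map /\ forall p, row_free (diff_map p).

(** The image under [d iota] of a vector field, a section of
    [iota^* T Mbar] *)
Definition push (Y : M -> 'rV[R]_n) : M -> 'rV[R]_N :=
  fun r => Y r *m diff_map r.

Definition induced_metric (g : Mbar -> 'M[R]_N) : M -> 'M[R]_n :=
  fun p => diff_map p *m g (iota p) *m (diff_map p)^T.

(** The derivative at [p], along the vector [v] tangent to [M], of a field [W]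
    along [iota] for the connection induced by [nablabar] on [iota^* T Mbar]:
    if [W = \sum_j W^j e_j] in the frame [e_j] of the chart at [iota p], this is
    [\sum_j (v(W^j) e_j + W^j nablabar_(d iota v) e_j)]. *)
Definition deriv_along
    (nablabar : Mbar -> 'rV[R]_N -> (Mbar -> 'rV[R]_N) -> 'rV[R]_N)
    (p : M) (v : 'rV[R]_n) (W : M -> 'rV[R]_N) : 'rV[R]_N :=
  dir_deriv p v (fun r => to_chart (iota p) (iota r) (W r))
  + \sum_(j < N)
      W p 0 j *: nablabar (iota p) (v *m diff_map p) (frame (iota p) j).

Variable g : Mbar -> 'M[R]_N.

(** The rows [w] with [g(w, d iota v) = 0] for all [v] span the normal space. *)
Definition normal_space (p : M) : 'M[R]_N :=
  kermx (g (iota p) *m (diff_map p)^T).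

(** The normal component of a vector [w] tangent to [Mbar] at [iota p], and
    the [v] tangent to [M] such that [d iota v] is its tangential component *)
Definition nor_part (p : M) (w : 'rV[R]_N) : 'rV[R]_N :=
  w *m proj_mx (normal_space p) <<diff_map p>>%MS.

Definition tan_part (p : M) (w : 'rV[R]_N) : 'rV[R]_n :=
  w *m proj_mx <<diff_map p>>%MS (normal_space p) *m pinvmx (diff_map p).

End Immersion.

Section Submanifold.
Context {R : realType} {m n : nat} {Mbar : sasakian R m} {M : manifold R n}.
Variable iota : M -> Mbar.
Local Notation g := (@sas_g R m Mbar).
Local Notation phi := (@sas_phi R m Mbar).
Local Notation D := (deriv_along iota (@sas_nabla R m Mbar)).
Implicit Types (p : M) (X Y : M -> 'rV[R]_n) (V : M -> 'rV[R]_((2 * m).+1)).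

Definition tangent_xi : Prop :=
  forall p, (sas_xi (iota p) <= diff_map iota p)%MS.

Definition op_P p (v : 'rV[R]_n) : 'rV[R]_n :=
  tan_part iota g p (v *m diff_map iota p *m phi (iota p)).

Definition op_F p (v : 'rV[R]_n) : 'rV[R]_((2 * m).+1) :=
  nor_part iota g p (v *m diff_map iota p *m phi (iota p)).

Definition op_f p (w : 'rV[R]_((2 * m).+1)) : 'rV[R]_((2 * m).+1) :=
  nor_part iota g p (w *m phi (iota p)).

(** Gauss and Weingarten: the normal components of the ambient derivative *)
Definition second_form X Y p : 'rV[R]_((2 * m).+1) :=
  nor_part iota g p (D p (X p) (push iota Y)).

Definition normal_conn X V p : 'rV[R]_((2 * m).+1) :=
  nor_part iota g p (D p (X p) V).

(** To be used with [nabla] the Levi-Civita connection of the induced metric *)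
Definition nabla_F (nabla : M -> 'rV[R]_n -> (M -> 'rV[R]_n) -> 'rV[R]_n)
    X Y p : 'rV[R]_((2 * m).+1) :=
  normal_conn X (fun r => op_F r (Y r)) p - op_F p (nabla p (X p) Y).

Definition F_parallel nabla : Prop :=
  forall X Y, smooth_vf X -> smooth_vf Y -> forall p, nabla_F nabla X Y p = 0.

End Submanifold.

(* Main.v *)
Require Import Defs.
From HB Require Import structures.
From mathcomp Require Import all_boot all_order all_fingroup all_algebra.
From mathcomp Require Import ring lra.
From mathcomp Require Import all_classical all_reals all_analysis.
Import Order.TTheory GRing.Theory Num.Theory.
Import numFieldNormedType.Exports.

(** Let [D] be the ambient Levi-Civita connection, acting on fields along the
    immersion.  The Sasakian condition gives
    [D_X (phi Y) = phi (D_X Y) + g(X, Y) xi - eta(Y) X], whose last two terms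
    are tangent to [M] since [xi] is.  Write [phi Y = P Y + F Y] on the left and,
    by the Gauss formula, [D_X Y = nabla_X Y + h(X, Y)] on the right, and take
    normal parts: [h(X, P Y) + nabla^perp_X (F Y) = F (nabla_X Y) + f h(X, Y)],
    which is the formula ([nabla_FE]).  The characterization of a parallel [F]
    is an immediate consequence.

    Each step must be justified for connections that are only known through
    their axioms on the manifold itself.

    - Connections are local and are expressed by Christoffel matrices in a chart
      ([conn_local], [conn_expand]), so that the metric compatibility and the
      Sasakian condition, stated for fields on the ambient manifold, pass to
      fields along the immersion ([deriv_along_metric], [deriv_along_phi]).

    - The Gauss formula ([gauss_formula]) amounts to the uniqueness of the
      Levi-Civita connection of the induced metric.  The difference of the two
      candidates is symmetric and, paired with a third field, skew in the last
      two arguments, hence zero.  Its symmetry rests on that of the second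
      derivatives of the immersion ([Schwarz_theorem]).

    - Splitting the derivative of [phi Y] into those of [P Y] and [F Y] requires
      these fields to be differentiable ([differentiable_along_op_P]).  This
      follows from the formula for the orthogonal projection in terms of the
      inverse of a Gram matrix ([tangential_chart], [differentiable_invmx]). *)

Set Implicit Arguments.
Unset Strict Implicit.
Unset Printing Implicit Defensive.

Local Open Scope classical_set_scope.
Local Open Scope ring_scope.

(** * Calculus of matrix-valued functions *)
Section MatrixCalculus.
Context {R : realType} {V : normedModType R}.

(** The differential is selected by a choice operator, so the differentials of
    functions equal near [x] must first be identified, by [diff_unique]. *)
Lemma near_eq_differentiable (W : normedModType R) (f g : V -> W) (x : V) :
  {near x, f =1 g} -> differentiable f x -> differentiable g x.
Proof.
move=> fg df.
have fgx : f x = g x by exact: nbhs_singleton fg.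
have dg : g \o shift x = cst (g x) + 'd f x +o_ (0 : V) id.
  apply/eqaddoP => e e0.
  have /eqaddoP/(_ _ e0) := diff_locally df.
  have fg0 : \forall h \near (0 : V), f (h + x) = g (h + x).
    rewrite (near_shift x) sub0r; near=> y.
    by rewrite /= subrK; near: y.
  apply: filter_app; near=> h => /=.
  rewrite !fctE /= /shift /=.
  by rewrite -fgx (near fg0 h).
have dc := diff_continuous df.
have E : 'd g x = 'd f x :> (V -> W) by exact: (diff_unique dc dg).
by apply/diff_locallyP; rewrite E.
Unshelve. all: by end_near. Qed.

Lemma differentiable_mxP (m n : nat) (f : V -> 'M[R]_(m, n)) (x : V) :
  differentiable f x <-> forall i j, differentiable (fun z => f z i j : R) x.
Proof.
split=> [df i j|df].
  exact: (differentiable_comp df (differentiable_coord _ _ _)).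
have -> : f = \sum_(i < m) \sum_(j < n)
    (fun z => f z i j *: (delta_mx i j : 'M[R]_(m, n))).
  apply/funext => z; rewrite fct_sumE [LHS]matrix_sum_delta.
  by apply: eq_bigr => i _; rewrite fct_sumE.
by do 2!(apply: differentiable_sum => ?); exact: differentiableZl.
Qed.

Lemma differentiable_mulmx (m n p : nat) (f : V -> 'M[R]_(m, n))
    (g : V -> 'M[R]_(n, p)) (x : V) :
  differentiable f x -> differentiable g x ->
  differentiable (fun z => f z *m g z) x.
Proof.
move=> /differentiable_mxP df /differentiable_mxP dg.
apply/differentiable_mxP => i j.
have -> : (fun z => (f z *m g z) i j) =
    \sum_(k < n) ((fun z => f z i k) * (fun z => g z k j)).
  by apply/funext => z; rewrite fct_sumE mxE.
by apply: differentiable_sum => k; exact: differentiableM.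
Qed.

Lemma derive_mulmx (m n p : nat) (f : V -> 'M[R]_(m, n))
    (g : V -> 'M[R]_(n, p)) (x v : V) :
  differentiable f x -> differentiable g x ->
  'D_v (fun z => f z *m g z) x = 'D_v f x *m g x + f x *m 'D_v g x.
Proof.
move=> df dg; have dfg := differentiable_mulmx df dg.
rewrite !derive_mx; try exact: diff_derivable.
move: df dg => /differentiable_mxP df /differentiable_mxP dg.
apply/matrixP => i j; rewrite !mxE.
have -> : (fun z => (f z *m g z) i j) =
    \sum_(k < n) ((fun z => f z i k) * (fun z => g z k j)).
  by apply/funext => z; rewrite fct_sumE mxE.
rewrite derive_sum => [|k]; last first.
  by apply: diff_derivable; exact: differentiableM.
rewrite -big_split; apply: eq_bigr => k _ /=.
rewrite deriveM; try exact: diff_derivable.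
by rewrite !mxE addrC; congr (_ + _); rewrite mulrC.
Qed.

Lemma derive_mulmxl (m n p : nat) (u : 'M[R]_(m, n)) (g : V -> 'M[R]_(n, p))
    (x v : V) :
  differentiable g x -> 'D_v (fun z => u *m g z) x = u *m 'D_v g x.
Proof.
move=> dg; have := derive_mulmx v (differentiable_cst u x) dg.
by rewrite derive_cst mul0mx add0r.
Qed.

Lemma differentiable_trmx (m n : nat) (f : V -> 'M[R]_(m, n)) (x : V) :
  differentiable f x -> differentiable (fun z => (f z)^T) x.
Proof.
move=> /differentiable_mxP df; apply/differentiable_mxP => i j.
by under eq_fun do rewrite mxE; exact: df.
Qed.

Lemma derive_trmx (m n : nat) (f : V -> 'M[R]_(m, n)) (x v : V) :
  differentiable f x -> 'D_v (fun z => (f z)^T) x = ('D_v f x)^T.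
Proof.
move=> df; rewrite !derive_mx; try exact: diff_derivable.
  by apply/matrixP => i j; rewrite !mxE; congr (derive _ x v); apply/funext => z;
    rewrite mxE.
exact/diff_derivable/differentiable_trmx.
Qed.

Lemma differentiable_det (n : nat) (f : V -> 'M[R]_n) (x : V) :
  differentiable f x -> differentiable (fun z => \det (f z) : R) x.
Proof.
move=> /differentiable_mxP df.
have -> : (fun z => \det (f z)) = \sum_(s : 'S_n)
    ((fun=> (-1) ^+ s : R) * \prod_(i < n) (fun z => f z i (s i))).
  apply/funext => z; rewrite fct_sumE; apply: eq_bigr => s _.
  by rewrite [RHS]/GRing.mul /= fct_prodE.
elim/big_ind: _ => [|u w du dw|s _].
- exact: differentiable_cst.
- exact: differentiableD.
apply: differentiableM; first exact: differentiable_cst.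
elim/big_ind: _ => [|u w du dw|i _].
- exact: differentiable_cst.
- exact: differentiableM.
exact: df.
Qed.

(** Cramer's rule: near [x] the determinant does not vanish, and the inverse is
    the adjugate divided by it, an expression polynomial in the entries. *)
Lemma differentiable_invmx (n : nat) (f : V -> 'M[R]_n) (x : V) :
  differentiable f x -> f x \in unitmx -> differentiable (fun z => invmx (f z)) x.
Proof.
move=> df ux; have cdet := differentiable_continuous (differentiable_det df).
have uz : \forall z \near x, \det (f z) != 0.
  have x0 : \det (f x) != 0 by rewrite -unitfE.
  apply: (cdet [set t | t != 0]).
  by apply: (open_nbhs_nbhs (conj (@open_neq _ 0) _)).
apply: (@near_eq_differentiable _
    (fun z => (\det (f z))^-1 *: \adj (f z))).
  by near=> z; rewrite /invmx unitmxE unitfE (near uz z).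
apply/differentiable_mxP => i j.
have -> : (fun z => ((\det (f z))^-1 *: \adj (f z)) i j) =
    (fun z => (\det (f z))^-1) *
    ((fun=> (-1) ^+ (j + i)) * (fun z => \det (row' j (col' i (f z))))).
  by apply/funext => z; rewrite !mxE.
apply: differentiableM.
  by apply: differentiableV; [exact: differentiable_det | rewrite -unitfE].
apply: differentiableM; first exact: differentiable_cst.
apply: differentiable_det; apply/differentiable_mxP => k l.
move/differentiable_mxP : df => df.
by under eq_fun do rewrite !mxE; exact: df.
Unshelve. all: by end_near. Qed.

Lemma derive_compE (U W : normedModType R) (f : V -> U) (g : U -> W) (x v : V) :
  differentiable f x -> differentiable g (f x) ->
  'D_v (g \o f) x = 'D_('D_v f x) g (f x).
Proof.
move=> df dg; rewrite (deriveE _ (differentiable_comp df dg)) (deriveE _ dg).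
by rewrite (deriveE _ df) diff_comp.
Qed.

End MatrixCalculus.

(** * Smooth functions of several variables *)
Section Smooth.
Context {R : realType} {n : nat}.
Implicit Types (W : normedModType R) (z : 'rV[R]_n) (s : seq 'I_n).

(** The iterated partial derivatives of [smooth_pt], named for the inductions
    below. *)
Definition iter_partial W (f : 'rV[R]_n -> W) s : 'rV[R]_n -> W :=
  foldr (fun i g x => 'D_(delta_mx 0 i) g x) f s.

Lemma near_eq_iter_partial W (f g : 'rV[R]_n -> W) z s :
  {near z, f =1 g} -> {near z, iter_partial f s =1 iter_partial g s}.
Proof.
move=> fg; elim: s => [//|i s IH]; have /= := near_join IH.
by apply: filterS => y; exact: near_eq_derive.
Qed.

Lemma near_eq_smooth W (f g : 'rV[R]_n -> W) z :
  {near z, f =1 g} -> smooth_pt f z -> smooth_pt g z.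
Proof.
by move=> fg sf s; apply: near_eq_differentiable (near_eq_iter_partial s fg) (sf s).
Qed.

Lemma smooth_differentiable W (f : 'rV[R]_n -> W) z :
  smooth_pt f z -> differentiable f z.
Proof. exact: (fun sf => sf [::]). Qed.

Lemma smooth_partial W (f : 'rV[R]_n -> W) z i :
  smooth_pt f z -> differentiable ('D_(delta_mx 0 i) f) z.
Proof. exact: (fun sf => sf [:: i]). Qed.

Lemma smooth_cst W (c : W) z : smooth_pt (fun=> c) z.
Proof.
move=> s; suff [d Ed] : exists d, iter_partial (fun=> c) s = fun=> d.
  by rewrite -/(iter_partial _ _) Ed; exact: differentiable_cst.
elim: s => [|i s [d Ed]]; first by exists c.
exists 0; rewrite /iter_partial/= -/(iter_partial _ _) Ed.
by apply/funext => y; rewrite derive_cst.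
Qed.

Lemma smooth_linear W (L : {linear 'rV[R]_n -> W}) z :
  continuous L -> smooth_pt L z.
Proof.
move=> cL s; have dL x : differentiable L x by exact: linear_differentiable.
elim/last_ind: s => [//|s i _]; rewrite foldr_rcons.
have -> : (fun x => 'D_(delta_mx 0 i) L x) = fun=> L (delta_mx 0 i).
  by apply/funext => x; rewrite deriveE // diff_lin.
exact: smooth_cst.
Qed.

(** A continuous linear map commutes with every partial derivative, but only
    where the function is differentiable: smoothness on a neighbourhood is what
    carries the induction over the iterated derivatives. *)
Lemma smooth_comp_linear W W' (L : {linear W -> W'}) (f : 'rV[R]_n -> W) z :
  continuous L -> (\forall y \near z, smooth_pt f y) ->
  \forall y \near z, smooth_pt (L \o f) y.
Proof.
move=> cL /near_join; apply: filterS => {}z sf s.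
have dL x : differentiable L x by exact: linear_differentiable.
have EL t : {near z, L \o iter_partial f t =1 iter_partial (L \o f) t}.
  elim: t => [|i t IH]; first by near=> y.
  have := near_join IH; apply: filter_app; near=> y => Ly.
  have dfy : differentiable (iter_partial f t) y by exact: (near sf y).
  rewrite /iter_partial /= -!/(iter_partial _ _) -(near_eq_derive _ Ly).
  by rewrite (derive_compE _ dfy (dL _)) (deriveE _ (dL _)) diff_lin.
apply: near_eq_differentiable (EL s) _.
by apply: differentiable_comp => //; exact: (nbhs_singleton sf).
Unshelve. all: by end_near. Qed.

Lemma smooth_add W (f g : 'rV[R]_n -> W) z :
  (\forall y \near z, smooth_pt f y) -> (\forall y \near z, smooth_pt g y) ->
  \forall y \near z, smooth_pt (fun x => f x + g x) y.
Proof.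
move=> /near_join + /near_join; apply: filterS2 => y sf sg s.
have E t : {near y, iter_partial f t + iter_partial g t
                    =1 iter_partial (fun x => f x + g x) t}.
  elim: t => [|i t IH]; first by near=> x.
  have := near_join IH; apply: filter_app; near=> x => Ex.
  have dfx : differentiable (iter_partial f t) x by exact: (near sf x).
  have dgx : differentiable (iter_partial g t) x by exact: (near sg x).
  rewrite /iter_partial /= -!/(iter_partial _ _) -(near_eq_derive _ Ex).
  by rewrite deriveD //; exact: diff_derivable.
apply: near_eq_differentiable (E s) _.
apply: differentiableD; [exact: (nbhs_singleton sf)|exact: (nbhs_singleton sg)].
Unshelve. all: by end_near. Qed.

(** Coordinates as functions with a canonical linear structure, to which
    [smooth_comp_linear] applies. *)
Definition mx_coord (m : nat) (j : 'I_m) (v : 'rV[R]_m) : R := v 0 j.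

Lemma mx_coord_is_linear (m : nat) (j : 'I_m) : linear (mx_coord j).
Proof. by move=> a u v; rewrite /mx_coord !mxE. Qed.

HB.instance Definition _ (m : nat) (j : 'I_m) :=
  GRing.isLinear.Build R 'rV[R]_m R _ (mx_coord j) (mx_coord_is_linear j).

Lemma smooth_coord (m : nat) (f : 'rV[R]_n -> 'rV[R]_m) z j :
  (\forall y \near z, smooth_pt f y) ->
  \forall y \near z, smooth_pt (fun x => f x 0 j : R) y.
Proof.
by move=> sf; apply: (smooth_comp_linear (L := mx_coord j)) sf; exact: coord_continuous.
Qed.

Lemma smooth_scale W (f : 'rV[R]_n -> R) (w : W) z :
  (\forall y \near z, smooth_pt f y) ->
  \forall y \near z, smooth_pt (fun x => f x *: w) y.
Proof.
move=> sf.
have lin : linear ( *:%R ^~ w : R -> W) by move=> a u v; rewrite scalerDl scalerA.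
pose LM := GRing.isLinear.Build _ _ _ _ _ lin.
pose L : {linear R -> W} := HB.pack ( *:%R ^~ w : R -> W) LM.
apply: (smooth_comp_linear (L := L)) sf; exact: scalel_continuous.
Qed.

(** The [i]-th row of the Jacobian matrix is the partial derivative in the
    direction [i], so this is the differentiability of first partials. *)
Lemma differentiable_jacobian (m : nat) (f : 'rV[R]_n -> 'rV[R]_m) z :
  (\forall y \near z, smooth_pt f y) -> differentiable (jacobian f) z.
Proof.
move=> sf; apply/differentiable_mxP => i j.
have /differentiable_mxP /(_ 0 j) := smooth_partial i (nbhs_singleton sf).
apply: near_eq_differentiable; near=> y.
rewrite deriveEjacobian; last exact: smooth_differentiable (near sf y _).
by rewrite -rowE mxE.
Unshelve. all: by end_near. Qed.

Lemma mulmx_ext (m p : nat) (A B : 'M[R]_(m, p)) :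
  (forall v : 'rV[R]_m, v *m A = v *m B) -> A = B.
Proof. by move=> AB; apply/row_matrixP => i; rewrite !rowE. Qed.

Lemma derive_chain_jacobian W (m : nat) (f : 'rV[R]_n -> 'rV[R]_m)
    (g : 'rV[R]_m -> W) z v :
  differentiable f z -> differentiable g (f z) ->
  'D_v (g \o f) z = 'D_(v *m jacobian f z) g (f z).
Proof. by move=> df dg; rewrite derive_compE // deriveEjacobian. Qed.

Lemma jacobian_comp (m p : nat) (f : 'rV[R]_n -> 'rV[R]_m)
    (g : 'rV[R]_m -> 'rV[R]_p) z :
  differentiable f z -> differentiable g (f z) ->
  jacobian (g \o f) z = jacobian f z *m jacobian g (f z).
Proof.
move=> df dg; apply: mulmx_ext => v; rewrite mulmxA.
rewrite -deriveEjacobian; last exact: differentiable_comp.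
by rewrite derive_chain_jacobian // deriveEjacobian.
Qed.

Lemma near_eq_jacobian (m : nat) (f g : 'rV[R]_n -> 'rV[R]_m) z :
  {near z, f =1 g} -> differentiable f z -> jacobian f z = jacobian g z.
Proof.
move=> fg df; have dg := near_eq_differentiable fg df.
apply: mulmx_ext => v.
apply: etrans (esym (deriveEjacobian v df)) _.
apply: etrans _ (deriveEjacobian v dg).
exact: near_eq_derive.
Qed.

Lemma jacobian_id z : jacobian (id : 'rV[R]_n -> 'rV[R]_n) z = 1%:M.
Proof.
have did : differentiable (id : 'rV[R]_n -> 'rV[R]_n) z by exact: ex_diff.
by apply: mulmx_ext => v; rewrite -(deriveEjacobian _ did) mulmx1 derive_id.
Qed.

End Smooth.

(** * Symmetry of second derivatives *)
Section Schwarz.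
Context {R : realType} {V : normedModType R}.

Lemma is_derive_line (f : V -> R) (w a : V) (s : R) :
  differentiable f (s *: a + w) ->
  is_derive s 1 (fun u => f (u *: a + w)) ('D_a f (s *: a + w)).
Proof.
move=> /(@diff_derivable _ _ _ _ _ a) df.
have E : (fun h : R => h^-1 *: (f ((h *: 1 + s) *: a + w) - f (s *: a + w))) =
         (fun h : R => h^-1 *: (f (h *: a + (s *: a + w)) - f (s *: a + w))).
  by apply/funext => h; rewrite scalerDl addrA [h *: 1]mulr1.
split; first by rewrite /derivable /= E.
by rewrite /derive /= E.
Qed.

(** The mean value theorem, applied to the increment along [b] as a function of
    the position on the segment along [a], turns the second difference into an
    increment of ['D_a f], which differentiability at [z] linearizes up to
    [o(t)]. *)
Lemma second_difference (f : V -> R) (z a b : V) :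
  (\forall y \near z, differentiable f y) -> differentiable ('D_a f) z ->
  forall e : R, 0 < e -> \forall t \near 0^'+,
    `|f (t *: a + (t *: b + z)) - f (t *: a + z) - (f (t *: b + z) - f z)
      - t ^+ 2 * 'D_b ('D_a f) z| <= e * t ^+ 2.
Proof.
move=> df dDf e e0.
(* The increments met below have norms at most t (|a| + |b|) and t |a|; the 1
   makes M positive. *)
pose M := 2 * `|a| + `|b| + 1.
have M0 : 0 < M by rewrite ltr_wpDl // addr_ge0 // mulr_ge0.
pose d := 'd ('D_a f) z.
have A : \forall h \near (0 : V),
    `|'D_a f (h + z) - 'D_a f z - d h| <= e / M * `|h|.
  have /eqaddoP/(_ _ (divr_gt0 e0 M0)) := diff_locally dDf.
  by apply: filterS => h; rewrite !fctE opprD addrA.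
have B : \forall h \near (0 : V), differentiable f (h + z).
  rewrite (near_shift z) sub0r; near=> y => /=.
  by rewrite subrK; near: y.
have [r /= r0 rP] := (nbhs_ballP _ _).1 (filterI A B).
have inball u c t : 0 < t -> t * M < r -> 0 <= u <= t -> 0 <= c <= t ->
    ball 0 r (u *: a + c *: b).
  move=> t0 tr /andP[u0 ut] /andP[c0 ct].
  rewrite -ball_normE /= sub0r normrN (le_lt_trans _ tr) //.
  rewrite (le_trans (ler_normD _ _)) // !normrZ !ger0_norm //.
  have : u * `|a| <= t * `|a| by rewrite ler_wpM2r.
  have : c * `|b| <= t * `|b| by rewrite ler_wpM2r.
  have : 0 <= t * `|a| by rewrite mulr_ge0 // ltW.
  by rewrite /M; lra.
near=> t.
have t0 : 0 < t by [].
have tr : t * M < r.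
  by rewrite -ltr_pdivlMr //; near: t; apply: nbhs_right_lt; rewrite divr_gt0.
have tt : 0 <= t <= t by rewrite lexx ltW.
have t00 : 0 <= (0 : R) <= t by rewrite lexx ltW.
pose phi (s : R) := f (s *: a + (t *: b + z)) - f (s *: a + z).
pose dphi (s : R) := 'D_a f (s *: a + (t *: b + z)) - 'D_a f (s *: a + z).
have Dphi s : 0 <= s <= t -> is_derive s 1 phi (dphi s).
  move=> st; apply: is_deriveB; apply: is_derive_line.
    by have [_] := rP _ (inball s t t t0 tr st tt); rewrite addrA.
  by have [_] := rP _ (inball s 0 t t0 tr st t00); rewrite scale0r addr0.
have [s st Es] : exists2 s, s \in `]0, t[%R & phi t - phi 0 = dphi s * (t - 0).
  apply: MVT => //.
    by move=> s; rewrite in_itv /= => /andP[/ltW ? /ltW ?]; apply: Dphi; apply/andP.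
  apply: derivable_within_continuous => s; rewrite in_itv /= => st.
  by have [] := Dphi s st.
have -> : f (t *: a + (t *: b + z)) - f (t *: a + z) - (f (t *: b + z) - f z)
  = phi t - phi 0 by rewrite /phi scale0r !add0r.
rewrite Es subr0.
have {}st : 0 <= s <= t.
  by move: st; rewrite in_itv /= => /andP[/ltW -> /ltW ->].
have [/= P1 _] := rP _ (inball s t t t0 tr st tt).
have [/= P2 _] := rP _ (inball s 0 t t0 tr st t00).
rewrite scale0r addr0 in P2.
pose da : R := d a; pose db : R := d b; pose g0 : R := 'D_a f z.
pose g1 : R := 'D_a f (s *: a + (t *: b + z)).
pose g2 : R := 'D_a f (s *: a + z).
have {}P1 : `|g1 - g0 - (s * da + t * db)| <= e / M * `|s *: a + t *: b|.
  move: P1; rewrite -(addrA (s *: a) (t *: b) z).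
  by rewrite linearD !linearZ.
have {}P2 : `|g2 - g0 - s * da| <= e / M * `|s *: a|.
  by move: P2; rewrite linearZ.
have -> : 'D_b ('D_a f) z = db by rewrite deriveE.
rewrite -[X in `|X|]/((g1 - g2) * t - t ^+ 2 * db).
have -> : (g1 - g2) * t - t ^+ 2 * db =
   t * ((g1 - g0 - (s * da + t * db)) - (g2 - g0 - s * da)) by ring.
rewrite normrM (ger0_norm (ltW t0)) expr2 [e * (t * t)]mulrCA ler_pM2l //.
rewrite (le_trans (ler_normB _ _)) // (le_trans (lerD P1 P2)) // -mulrDr.
rewrite -mulrA ler_pM2l // ler_pdivrMl //.
have N1 : `|s *: a + t *: b| <= t * `|a| + t * `|b|.
  case/andP: st => s0 st.
  rewrite (le_trans (ler_normD _ _)) // !normrZ !ger0_norm ?(ltW t0) //.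
  by rewrite lerD2r ler_wpM2r.
have N2 : `|s *: a| <= t * `|a|.
  by case/andP: st => s0 st; rewrite normrZ ger0_norm // ler_wpM2r.
by rewrite (le_trans (lerD N1 N2)) // /M; lra.
Unshelve. all: by end_near. Qed.

(** The second difference is symmetric in [a] and [b], so dividing it by
    [t ^+ 2] gives both mixed derivatives as limits of the same quantity. *)
Lemma Schwarz_theorem (f : V -> R) (z a b : V) :
  (\forall y \near z, differentiable f y) ->
  differentiable ('D_a f) z -> differentiable ('D_b f) z ->
  'D_b ('D_a f) z = 'D_a ('D_b f) z.
Proof.
move=> df da db; apply/eqP; rewrite -subr_eq0 -normr_le0.
apply/ler_addgt0Pr => e e0; rewrite add0r.
have e2 : 0 < e / 2 by rewrite divr_gt0.
have Qa := second_difference b df da e2.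
have Qb := second_difference a df db e2.
have : \forall t \near (0 : R)^'+, `|'D_b ('D_a f) z - 'D_a ('D_b f) z| <= e.
  have Q0 : \forall t \near (0 : R)^'+, 0 < t by exact: nbhs_right_gt.
  apply: filterS3 Q0 Qa Qb => t t0.
  rewrite [t *: b + (t *: a + z)]addrCA.
  set D1 := 'D_b _ z; set D2 := 'D_a _ z.
  (* x2 and x3 are exchanged between the two second differences. *)
  set x1 := f _; set x2 := f _; set x3 := f _; set x4 := f _ => P1 P2.
  have t2 : 0 < t ^+ 2 by rewrite exprn_gt0.
  rewrite -(ler_pM2l t2) -[X in X * _ <= _](ger0_norm (ltW t2)) -normrM.
  have -> : t ^+ 2 * (D1 - D2) =
    (x1 - x3 - (x2 - x4) - t ^+ 2 * D2) - (x1 - x2 - (x3 - x4) - t ^+ 2 * D1).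
    by ring.
  rewrite (le_trans (ler_normB _ _)) // (le_trans (lerD P2 P1)) //.
  by rewrite -mulrDl -splitr mulrC.
by move=> /filter_ex[].
Qed.

End Schwarz.

(** * Changes of charts *)
Section Charts.
Context {R : realType} {n : nat} {M : manifold R n}.
Implicit Types (p q r a b c : M) (X Y : M -> 'rV[R]_n).

Lemma near_chart_inv p q (P : M -> Prop) : chart_dom p q ->
  (\forall r \near q, P r) -> \forall z \near chart p q, P (chart_inv p z).
Proof.
move=> pq; have : chart_inv p @ chart p q --> chart_inv p (chart p q).
  exact: chart_inv_continuous.
by rewrite chartK //; apply.
Qed.

Lemma near_chart_point p q (P : 'rV[R]_n -> Prop) : chart_dom p q ->
  (\forall z \near chart p q, P z) -> \forall r \near q, P (chart p r).
Proof. by move=> pq; have := chart_continuous pq; apply. Qed.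

Lemma near_chart_dom p q : chart_dom p q -> \forall r \near q, chart_dom p r.
Proof. by move=> pq; apply: open_nbhs_nbhs; split=> //; exact: chart_dom_open. Qed.

Lemma near_chart_invK p q : chart_dom p q ->
  \forall z \near chart p q, chart p (chart_inv p z) = z.
Proof.
move=> pq; have : nbhs (chart p q) (chart p @` chart_dom p).
  by apply: open_nbhs_nbhs; split; [exact: chart_image_open|exists q].
by apply: filterS => _ [r pr <-]; rewrite chartK.
Qed.

(** The change of components at [r] from the chart of [a] to that of [b]; both
    [to_chart] and [frame] are instances of it, with [r] as one of the charts. *)
Definition trans a b r : 'M[R]_n := jacobian (chart b \o chart_inv a) (chart a r).

Lemma differentiable_transition a b r : chart_dom a r -> chart_dom b r ->
  differentiable (chart b \o chart_inv a) (chart a r).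
Proof. by move=> ar br; apply: smooth_differentiable; exact: chart_transition. Qed.

(** The cocycle rule of the tangent bundle, which is the chain rule. *)
Lemma trans_comp a b c r : chart_dom a r -> chart_dom b r -> chart_dom c r ->
  trans a b r *m trans b c r = trans a c r.
Proof.
move=> ar br cr; rewrite /trans.
have Eb : (chart b \o chart_inv a) (chart a r) = chart b r by rewrite /= chartK.
rewrite -[in X in _ *m X]Eb -jacobian_comp; first last.
- by rewrite Eb; exact: differentiable_transition.
- exact: differentiable_transition.
apply/esym/near_eq_jacobian; last exact: differentiable_transition.
have := near_chart_inv ar (near_chart_dom br).
by apply: filterS => z bz /=; rewrite chartK.
Qed.

Lemma trans_id a r : chart_dom a r -> trans a a r = 1%:M.
Proof.
move=> ar; rewrite /trans -(jacobian_id (chart a r)).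
apply: near_eq_jacobian; last exact: differentiable_transition.
exact: near_chart_invK.
Qed.

Lemma trans_inv a b r : chart_dom a r -> chart_dom b r ->
  trans a b r *m trans b a r = 1%:M.
Proof. by move=> ar br; rewrite trans_comp // trans_id. Qed.

Lemma to_chart_center p v : to_chart p p v = v.
Proof.
rewrite -[LHS]/(v *m trans p p p) trans_id ?mulmx1 //.
exact: chart_dom_center.
Qed.

(** The local field with constant components [u] in the chart of [p]; for [u] a
    basis vector it is [frame p].  Such fields extend any tangent vector at [p]. *)
Definition const_field p (u : 'rV[R]_n) : M -> 'rV[R]_n := fun r => u *m trans p r r.

Lemma to_chart_const_field p u r : chart_dom p r ->
  to_chart p r (const_field p u r) = u.
Proof.
move=> pr; rewrite -[LHS]/(u *m trans p r r *m trans r p r) -mulmxA.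
by rewrite trans_inv ?mulmx1 //; exact: chart_dom_center.
Qed.

Lemma const_field_center p u : const_field p u p = u.
Proof. by rewrite /const_field trans_id ?mulmx1 //; exact: chart_dom_center. Qed.

Lemma const_field_to_chart p r v : chart_dom p r ->
  const_field p (to_chart p r v) r = v.
Proof.
move=> pr; rewrite -[LHS]/(v *m trans r p r *m trans p r r) -mulmxA.
by rewrite trans_inv ?mulmx1 //; exact: chart_dom_center.
Qed.

Lemma near_at_center p (P : M -> Prop) :
  (\forall r \near p, P r) -> \forall z \near chart p p, P (chart_inv p z).
Proof. exact/near_chart_inv/chart_dom_center. Qed.

Lemma near_dom_center p : \forall r \near p, chart_dom p r.
Proof. exact/near_chart_dom/chart_dom_center. Qed.

Lemma near_eq_smooth_near (W : normedModType R) p (u w : M -> W) :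
  (\forall r \near p, u r = w r) -> smooth_near p u -> smooth_near p w.
Proof.
move=> /near_at_center /near_join uw su; rewrite /smooth_near; near=> z.
by apply: near_eq_smooth; [exact: (near uw z)|exact: (near su z)].
Unshelve. all: by end_near. Qed.

Lemma near_eq_dir_deriv (W : normedModType R) p v (u w : M -> W) :
  (\forall r \near p, u r = w r) -> dir_deriv p v u = dir_deriv p v w.
Proof. by move=> /near_at_center uw; exact: near_eq_derive. Qed.

Lemma smooth_near_cst (W : normedModType R) p (c : W) : smooth_near p (fun=> c).
Proof.
rewrite /smooth_near; near=> z; exact: smooth_cst.
Unshelve. all: by end_near. Qed.

Lemma smooth_near_differentiable (W : normedModType R) p (u : M -> W) :
  smooth_near p u -> differentiable (u \o chart_inv p) (chart p p).
Proof. by move=> /nbhs_singleton; exact: smooth_differentiable. Qed.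

Lemma vf_smooth_const_field p u : vf_smooth_near p (const_field p u).
Proof.
apply: near_eq_smooth_near (smooth_near_cst p u).
by apply: filterS (near_dom_center p) => r pr; rewrite to_chart_const_field.
Qed.

(** Coordinate functions: their directional derivatives are the components of a
    tangent vector, so testing the torsion on them determines it. *)
Definition chart_coord p (k : 'I_n) : M -> R := fun r => chart p r 0 k.

Lemma smooth_chart_coord p k : smooth_near p (chart_coord p k).
Proof.
rewrite /smooth_near /chart_coord; apply: smooth_coord.
have /near_join := near_chart_invK (chart_dom_center p).
apply: filterS => z Ez; apply: (@near_eq_smooth _ _ _ id).
  by apply: filterS Ez => y ->.
by apply: (smooth_linear (L := idfun)) => x.
Qed.

Lemma dir_deriv_chart_coord p k r v : chart_dom p r ->
  dir_deriv r v (chart_coord p k) = to_chart p r v 0 k.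
Proof.
move=> pr; rewrite /dir_deriv /to_chart.
have rr := chart_dom_center r.
have dt := differentiable_transition rr pr.
rewrite -(deriveEjacobian v dt) derive_mx; last exact: diff_derivable.
by rewrite mxE.
Qed.

End Charts.

(** * Connections in a chart *)
Section Connections.
Context {R : realType} {n : nat} {M : manifold R n}.
Variable nabla : M -> 'rV[R]_n -> (M -> 'rV[R]_n) -> 'rV[R]_n.
Implicit Types (p q r : M) (X Y Z : M -> 'rV[R]_n) (u v w : 'rV[R]_n).

Lemma vf_smooth_scale p (f : M -> R) u :
  smooth_near p f -> vf_smooth_near p (fun r => f r *: const_field p u r).
Proof.
move=> sf; apply: (@near_eq_smooth_near _ _ _ _ _ (fun r => f r *: u)).
  apply: filterS (near_dom_center p) => r pr.
  by rewrite /to_chart -scalemxAl -/(to_chart p r _) to_chart_const_field.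
exact: (smooth_scale u sf).
Qed.

Lemma vf_smooth_add p Y Z : vf_smooth_near p Y -> vf_smooth_near p Z ->
  vf_smooth_near p (fun r => Y r + Z r).
Proof.
move=> sY sZ; apply: near_eq_smooth_near (smooth_add sY sZ).
by near=> r; rewrite /to_chart mulmxDl.
Unshelve. all: by end_near. Qed.

Lemma vf_smooth0 p : vf_smooth_near p (fun=> 0).
Proof.
apply: near_eq_smooth_near (smooth_near_cst p 0).
by near=> r; rewrite /to_chart mul0mx.
Unshelve. all: by end_near. Qed.

Lemma vf_smooth_sum p (I : Type) (s : seq I) (Y : I -> M -> 'rV[R]_n) :
  (forall i, vf_smooth_near p (Y i)) ->
  vf_smooth_near p (fun r => \sum_(i <- s) Y i r).
Proof.
move=> sY; elim: s => [|i s IH].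
  by under eq_fun do rewrite big_nil; exact: vf_smooth0.
by under eq_fun do rewrite big_cons; exact: vf_smooth_add.
Qed.

Hypothesis nabla_conn : connection nabla.

Lemma conn_zero p v : nabla p v (fun=> 0) = 0.
Proof.
have := conn_add nabla_conn v (vf_smooth0 p) (vf_smooth0 p).
under eq_fun do rewrite addr0.
by move=> /eqP; rewrite -[X in X == _]addr0 (inj_eq (addrI _)) eq_sym => /eqP.
Qed.

Lemma conn_sum p v (I : Type) (s : seq I) (Y : I -> M -> 'rV[R]_n) :
  (forall i, vf_smooth_near p (Y i)) ->
  nabla p v (fun r => \sum_(i <- s) Y i r) = \sum_(i <- s) nabla p v (Y i).
Proof.
move=> sY; elim: s => [|i s IH].
  by under eq_fun do rewrite big_nil; rewrite conn_zero big_nil.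
under eq_fun do rewrite big_cons.
by rewrite (conn_add nabla_conn) ?big_cons ?IH //; exact: vf_smooth_sum.
Qed.

(** The Leibniz rule for the indicator function of the set where [Y] and [Z]
    agree, which is locally constant and equal to 1 at [p]; multiplied by it the
    two fields become equal everywhere. *)
Lemma conn_local p v Y Z : (\forall r \near p, Y r = Z r) ->
  vf_smooth_near p Y -> vf_smooth_near p Z -> nabla p v Y = nabla p v Z.
Proof.
move=> YZ sY sZ.
pose f r : R := if `[< Y r = Z r >] then 1 else 0.
have f1 : \forall r \near p, 1 = f r.
  by apply: filterS YZ => r Yr; rewrite /f asboolT.
have sf : smooth_near p f.
  apply: (@near_eq_smooth_near _ _ _ _ p (fun=> 1 : R) f f1).
  exact: smooth_near_cst.
have df : dir_deriv p v f = 0.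
  rewrite -(@near_eq_dir_deriv _ _ _ _ p v (fun=> 1 : R) f f1).
  by rewrite /dir_deriv derive_cst.
have fYZ : (fun r => f r *: Y r) = (fun r => f r *: Z r).
  apply/funext => r; rewrite /f; case: asboolP => [->//|_].
  by rewrite !scale0r.
have := conn_leibniz nabla_conn v sf sY; rewrite fYZ (conn_leibniz nabla_conn v sf sZ).
by rewrite df -(nbhs_singleton f1) !scale0r !add0r !scale1r.
Qed.

(** Row [j] holds the covariant derivative of the [j]-th coordinate field, so
    that [u *m christoffel p v] is the derivative of the field of constant
    components [u]: the Christoffel symbols contracted with the direction. *)
Definition christoffel p v : 'M[R]_n := \matrix_j nabla p v (frame p j).

Lemma conn_const_field p v u :
  nabla p v (const_field p u) = u *m christoffel p v.
Proof.
have -> : const_field p u = fun r => \sum_j (u 0 j *: const_field p (delta_mx 0 j) r).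
  apply/funext => r; rewrite /const_field {1}[u]row_sum_delta mulmx_suml.
  by apply: eq_bigr => j _; rewrite scalemxAl.
rewrite conn_sum => [|j]; last first.
  by apply: vf_smooth_scale => //; exact: smooth_near_cst.
rewrite mulmx_sum_row; apply: eq_bigr => j _.
rewrite (conn_leibniz nabla_conn); last 2 first.
- exact: smooth_near_cst.
- exact: vf_smooth_const_field.
by rewrite /dir_deriv derive_cst scale0r add0r rowK.
Qed.

(** A connection is the derivative of the components plus a Christoffel term;
    it suffices to expand the field in the coordinate frame, which is possible
    near [p] only, and to use locality and the Leibniz rule. *)
Lemma conn_expand p v Y : vf_smooth_near p Y ->
  nabla p v Y = dir_deriv p v (fun r => to_chart p r (Y r)) + Y p *m christoffel p v.
Proof.
move=> sY; pose Yhat r := to_chart p r (Y r).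
have E : \forall r \near p, Y r = \sum_j (Yhat r 0 j *: const_field p (delta_mx 0 j) r).
  apply: filterS (near_dom_center p) => r pr.
  rewrite -[LHS](const_field_to_chart (Y r) pr) -/(Yhat r) /const_field.
  rewrite {1}[Yhat r]row_sum_delta mulmx_suml.
  by apply: eq_bigr => j _; rewrite scalemxAl.
have sYj j : smooth_near p (fun r => Yhat r 0 j) by exact: smooth_coord.
have sj j : vf_smooth_near p (fun r => Yhat r 0 j *: const_field p (delta_mx 0 j) r).
  exact: vf_smooth_scale.
rewrite (conn_local v E sY) ?conn_sum //; last exact: vf_smooth_sum.
under eq_bigr => j _ do
  rewrite (conn_leibniz nabla_conn _ (sYj j) (vf_smooth_const_field p _)).
rewrite big_split /=; congr (_ + _).
  rewrite [RHS]row_sum_delta; apply: eq_bigr => j _.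
  rewrite const_field_center; congr (_ *: _).
  rewrite /dir_deriv derive_mx ?mxE //; apply: diff_derivable.
  exact: smooth_near_differentiable.
rewrite mulmx_sum_row; apply: eq_bigr => j _.
by rewrite /Yhat to_chart_center rowK.
Qed.

End Connections.

Lemma form_delta (R : realType) (n : nat) (A : 'M[R]_n) (i j : 'I_n) :
  ((delta_mx 0 i : 'rV_n) *m A *m (delta_mx 0 j : 'rV_n)^T) 0 0 = A i j.
Proof. by rewrite trmx_delta -rowE -colE !mxE. Qed.

(** * Levi-Civita connections in a chart *)
Section LeviCivita.
Context {R : realType} {n : nat} {M : manifold R n}.
Variables (g : M -> 'M[R]_n) (nabla : M -> 'rV[R]_n -> (M -> 'rV[R]_n) -> 'rV[R]_n).
Hypothesis nabla_lc : levi_civita g nabla.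
Implicit Types (p q r : M) (X Y Z : M -> 'rV[R]_n) (u v w : 'rV[R]_n).

(** Torsion-freeness, tested on the coordinate functions, gives the bracket of
    the two fields by its coordinate formula. *)
Lemma lc_bracket p X Y : vf_smooth_near p X -> vf_smooth_near p Y ->
  nabla p (X p) Y - nabla p (Y p) X =
  dir_deriv p (X p) (fun r => to_chart p r (Y r))
  - dir_deriv p (Y p) (fun r => to_chart p r (X r)).
Proof.
move=> sX sY; apply/rowP => k.
have pp := chart_dom_center p.
have := lc_torsion_free nabla_lc sX sY (smooth_chart_coord p k).
rewrite dir_deriv_chart_coord // to_chart_center => ->.
have E v Z : vf_smooth_near p Z ->
    dir_deriv p v (fun r => dir_deriv r (Z r) (chart_coord p k)) =
    dir_deriv p v (fun r => to_chart p r (Z r)) 0 k.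
  move=> sZ; rewrite [in RHS]/dir_deriv derive_mx.
    rewrite mxE (@near_eq_dir_deriv _ _ _ _ p v _
      (fun r => to_chart p r (Z r) 0 k : R)) //.
    by apply: filterS (near_dom_center p) => r pr; rewrite dir_deriv_chart_coord.
  by apply: diff_derivable; exact: smooth_near_differentiable.
by rewrite !E // mxE; congr (_ + _); rewrite mxE.
Qed.

(** Fields of constant components have zero bracket. *)
Lemma christoffel_sym p u w : u *m christoffel nabla p w = w *m christoffel nabla p u.
Proof.
have H v z : dir_deriv p v (fun r => to_chart p r (const_field p z r)) = 0.
  rewrite (@near_eq_dir_deriv _ _ _ _ p v _ (fun=> z)) ?/dir_deriv ?derive_cst //.
  by apply: filterS (near_dom_center p) => r pr; rewrite to_chart_const_field.
have := lc_bracket (vf_smooth_const_field p w) (vf_smooth_const_field p u).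
have nc := lc_connection nabla_lc.
rewrite !const_field_center !conn_const_field // !H subrr.
by move/eqP; rewrite subr_eq0 => /eqP.
Qed.

(** The Gram matrix of the coordinate frame of [p], as a function of the
    coordinates. *)
Definition chart_metric p (y : 'rV[R]_n) : 'M[R]_n :=
  let r := chart_inv p y in trans p r r *m g r *m (trans p r r)^T.

Lemma chart_metricE p y : forall i j, chart_metric p y i j =
  inner g (chart_inv p y) (frame p i (chart_inv p y)) (frame p j (chart_inv p y)).
Proof.
move=> i j; rewrite /inner /frame -/(trans p _ _) trmx_mul !mulmxA.
by rewrite -form_delta !mulmxA.
Qed.

Hypothesis g_metric : riemannian_metric g.

Lemma differentiable_chart_metric p : differentiable (chart_metric p) (chart p p).
Proof.
apply/differentiable_mxP => i j; under eq_fun do rewrite chart_metricE.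
exact: (smooth_near_differentiable (metric_smooth g_metric
  (vf_smooth_const_field p (delta_mx 0 i)) (vf_smooth_const_field p (delta_mx 0 j)))).
Qed.

(** Metric compatibility for pairs of coordinate fields. *)
Lemma derive_chart_metric p v : 'D_v (chart_metric p) (chart p p) =
  christoffel nabla p v *m g p + g p *m (christoffel nabla p v)^T.
Proof.
have dG := differentiable_chart_metric p.
rewrite derive_mx; last exact: diff_derivable.
apply/matrixP => i j; rewrite mxE.
under eq_fun do rewrite chart_metricE.
have := lc_metric nabla_lc v (vf_smooth_const_field p (delta_mx 0 i))
  (vf_smooth_const_field p (delta_mx 0 j)).
rewrite /dir_deriv /= => ->; rewrite !const_field_center /inner.
have nc := lc_connection nabla_lc.
rewrite !conn_const_field // trmx_mul [RHS]mxE -(form_delta (_ *m g p)).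
by rewrite -(form_delta (g p *m _)) !mulmxA.
Qed.

End LeviCivita.

(** * The Sasakian structure in a chart *)
Section SasakianChart.
Context {R : realType} {m : nat} {M : sasakian R m}.
Local Notation phi := (@sas_phi R m M).
Local Notation Gamma := (christoffel (@sas_nabla R m M)).

(** The matrix of [phi] in the coordinate frame of [p], as a function of the
    coordinates. *)
Definition chart_phi (p : M) (y : 'rV[R]_((2 * m).+1)) : 'M[R]_((2 * m).+1) :=
  let r := chart_inv p y in trans p r r *m phi r *m trans r p r.

Lemma mul_chart_phi p u y : u *m chart_phi p y =
  to_chart p (chart_inv p y) (const_field p u (chart_inv p y) *m phi (chart_inv p y)).
Proof. by rewrite /to_chart /const_field /chart_phi !mulmxA. Qed.

Lemma differentiable_chart_phi p : differentiable (chart_phi p) (chart p p).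
Proof.
apply/differentiable_mxP => i j.
have sphi := sas_phi_smooth (vf_smooth_const_field p (delta_mx 0 i)).
have := smooth_near_differentiable sphi.
move=> /differentiable_mxP /(_ 0 j); congr (differentiable _ _).
by apply/funext => y /=; rewrite -mul_chart_phi -rowE mxE.
Qed.

(** The Sasakian condition for fields of constant components: the covariant
    derivative of [phi] is the derivative of its matrix plus the commutator with
    the Christoffel matrix. *)
Lemma derive_chart_phi (p : M) u v :
  u *m 'D_v (chart_phi p) (chart p p) + u *m phi p *m Gamma p v
    - u *m Gamma p v *m phi p =
  inner (@sas_g R m M) p v u *: sas_xi p - (u *m sas_eta p) 0 0 *: v.
Proof.
have sU := vf_smooth_const_field p u.
have := sas_nabla_phi v sU; rewrite const_field_center => <-.
have nc := lc_connection (sas_levi_civita M).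
rewrite conn_const_field // conn_expand //; last exact: sas_phi_smooth.
rewrite const_field_center; congr (_ + _ - _).
have dphi := differentiable_chart_phi p.
apply: etrans (esym (derive_mulmxl u v dphi)) _; rewrite /dir_deriv.
suff -> : (fun z => u *m chart_phi p z)
    = (fun r => to_chart p r (const_field p u r *m phi r)) \o chart_inv p by [].
by apply/funext => y; rewrite mul_chart_phi.
Qed.

End SasakianChart.

(** * Orthogonal projection onto a row space *)
Section OrthogonalProjection.
Context {R : realType} {n N : nat}.
Variables (G : 'M[R]_N) (D : 'M[R]_(n, N)).
Hypothesis G_pos : forall v : 'rV[R]_N, v != 0 -> 0 < (v *m G *m v^T) 0 0.
Hypothesis D_free : row_free D.
Local Notation Q := (D *m G *m D^T).
Local Notation K := (kermx (G *m D^T)).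
Local Notation E := <<D>>%MS.

Lemma isotropic_eq0 (v : 'rV[R]_N) : v *m G *m v^T = 0 -> v = 0.
Proof.
move=> v0; apply/eqP; apply: contraT => /G_pos.
by rewrite v0 mxE ltxx.
Qed.

(** A vector in the kernel of the Gram matrix of the rows of [D] has an
    isotropic image in their span, hence a zero one. *)
Lemma gram_unit : Q \in unitmx.
Proof.
rewrite -row_free_unit; apply: inj_row_free => v vQ0.
suff vD0 : v *m D = 0 by apply: (row_free_inj D_free); rewrite mul0mx.
apply: isotropic_eq0; rewrite trmx_mul !mulmxA.
by rewrite -(mulmxA v) -(mulmxA v) vQ0 mul0mx.
Qed.

Lemma tangent_normal_cap : (E :&: K = 0)%MS.
Proof.
apply/eqP/rowV0P => v; rewrite sub_capmx genmxE => /andP[/submxP[u ->]].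
move=> /sub_kermxP uG; apply: isotropic_eq0.
by rewrite trmx_mul -mulmxA [G *m _]mulmxA mulmxA uG mul0mx.
Qed.

Let coeff (w : 'rV[R]_N) := w *m G *m D^T *m invmx Q.

Lemma residual_normal w : (w - coeff w *m D <= K)%MS.
Proof.
apply/sub_kermxP; rewrite mulmxBl /coeff -!mulmxA.
by rewrite [D *m (G *m _)]mulmxA mulVmx ?gram_unit // mulmx1 subrr.
Qed.

(** The coefficients of the orthogonal projection solve the normal equations.
    This closed form, unlike [proj_mx], visibly depends differentiably on [G]
    and [D]. *)
Lemma tangent_coeffE w : w *m proj_mx E K *m pinvmx D = coeff w.
Proof.
rewrite -{1}[w](subrK (coeff w *m D)) mulmxDl.
rewrite (proj_mx_0 tangent_normal_cap) ?residual_normal //.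
rewrite add0r (proj_mx_id tangent_normal_cap) ?genmxE ?submxMl //.
by rewrite -mulmxA mulmxVp // mulmx1.
Qed.

Lemma normal_projE w : w *m proj_mx K E = w - coeff w *m D.
Proof.
have cap : (K :&: E = 0)%MS by rewrite capmxC tangent_normal_cap.
rewrite -{1}[w](subrK (coeff w *m D)) mulmxDl (proj_mx_id cap) ?residual_normal //.
by rewrite (proj_mx_0 cap) ?addr0 // genmxE submxMl.
Qed.

Lemma normal_proj_tangent (v : 'rV[R]_n) : v *m D *m proj_mx K E = 0.
Proof.
have cap : (K :&: E = 0)%MS by rewrite capmxC tangent_normal_cap.
by rewrite (proj_mx_0 cap) // genmxE submxMl.
Qed.

Lemma normal_proj_normal (w : 'rV[R]_N) : w *m G *m D^T = 0 -> w *m proj_mx K E = w.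
Proof. by move=> w0; rewrite normal_projE /coeff w0 !mul0mx subr0. Qed.

End OrthogonalProjection.

(** * Differentiation along a smooth map *)
Section Immersions.
Context {R : realType} {n N : nat} {M : manifold R n} {Mbar : manifold R N}.
Variable iota : M -> Mbar.
Hypothesis iota_smooth : smooth_map iota.
Implicit Types (p r : M) (X Y : M -> 'rV[R]_n) (V W : M -> 'rV[R]_N).

Definition local_map p := chart (iota p) \o iota \o chart_inv p.

Lemma smooth_local_map p : \forall z \near chart p p, smooth_pt (local_map p) z.
Proof. exact: iota_smooth.2. Qed.

Lemma local_map_center p : local_map p (chart p p) = chart (iota p) (iota p).
Proof. by rewrite /local_map /= chartK //; exact: chart_dom_center. Qed.

Lemma near_iota p (P : Mbar -> Prop) :
  (\forall s \near iota p, P s) -> \forall r \near p, P (iota r).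
Proof. by have := iota_smooth.1 p; apply. Qed.

(** [diff_map iota r] is written in the charts at [r] and [iota r].  Both sides
    are the Jacobian of [iota] read in the charts of [r] and of [iota p]. *)
Lemma diff_map_chart p r : chart_dom p r -> chart_dom (iota p) (iota r) ->
  smooth_pt (local_map p) (chart p r) ->
  diff_map iota r *m trans (iota r) (iota p) (iota r)
  = trans r p r *m jacobian (local_map p) (chart p r).
Proof.
move=> pr qr /smooth_differentiable dl.
have rr := chart_dom_center r; have ss := chart_dom_center (iota r).
have dr := smooth_differentiable (nbhs_singleton (smooth_local_map r)).
have dpr := differentiable_transition rr pr.
have dqr := differentiable_transition ss qr.
have Er : (chart p \o chart_inv r) (chart r r) = chart p r by rewrite /= chartK.
have dl' : differentiable (local_map p) ((chart p \o chart_inv r) (chart r r)).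
  by rewrite Er.
have dqr' : differentiable (chart (iota p) \o chart_inv (iota r))
    (local_map r (chart r r)).
  by rewrite local_map_center.
have E1 := jacobian_comp dr dqr'; rewrite local_map_center in E1.
have E2 := jacobian_comp dpr dl'; rewrite Er in E2.
apply: etrans (esym E1) (etrans _ E2).
apply: near_eq_jacobian; last exact: differentiable_comp dr dqr'.
have Cp := near_at_center (near_chart_dom pr).
have Cq := near_at_center (near_iota (near_dom_center (iota r))).
by apply: filterS2 Cp Cq => z pz qz; rewrite /local_map /= !chartK.
Qed.

Lemma near_diff_map_chart p : \forall r \near p, [/\ chart_dom p r,
  chart_dom (iota p) (iota r) & diff_map iota r *m trans (iota r) (iota p) (iota r)
  = trans r p r *m jacobian (local_map p) (chart p r)].
Proof.
have C1 := near_dom_center p; have C2 := near_iota (near_dom_center (iota p)).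
have C3 := near_chart_point (chart_dom_center p) (smooth_local_map p).
near=> r.
have r1 : chart_dom p r by exact: (near C1 r).
have r2 : chart_dom (iota p) (iota r) by exact: (near C2 r).
by split => //; apply: diff_map_chart => //; exact: (near C3 r).
Unshelve. all: by end_near. Qed.

(** The components, in the fixed chart at [iota p], of a field along [iota], as a
    function of the coordinates on [M]. *)
Definition along_chart p W : 'rV[R]_n -> 'rV[R]_N :=
  (fun r => to_chart (iota p) (iota r) (W r)) \o chart_inv p.

Definition differentiable_along p W := differentiable (along_chart p W) (chart p p).

Lemma along_chart_center p W : along_chart p W (chart p p) = W p.
Proof.
by rewrite /along_chart /= chartK ?to_chart_center //; exact: chart_dom_center.
Qed.

Lemma push_chart p Y : \forall z \near chart p p, along_chart p (push iota Y) z =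
  to_chart p (chart_inv p z) (Y (chart_inv p z)) *m jacobian (local_map p) z.
Proof.
have C1 := near_at_center (near_diff_map_chart p).
have C2 := near_chart_invK (chart_dom_center p).
apply: filterS2 C1 C2 => z [_ _ c3] c4.
rewrite c4 in c3.
exact: etrans (esym (mulmxA _ _ _)) (etrans (congr1 (mulmx _) c3) (mulmxA _ _ _)).
Qed.

Lemma differentiable_along_push p Y :
  vf_smooth_near p Y -> differentiable_along p (push iota Y).
Proof.
move=> sY; have dY := smooth_near_differentiable sY.
have dJ := differentiable_jacobian (smooth_local_map p).
have := differentiable_mulmx dY dJ; apply: near_eq_differentiable.
by apply: filterS (push_chart p Y) => z ->.
Qed.

Lemma dir_deriv_push p v Y : vf_smooth_near p Y ->
  'D_v (along_chart p (push iota Y)) (chart p p) =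
  dir_deriv p v (fun r => to_chart p r (Y r)) *m diff_map iota p
  + Y p *m 'D_v (jacobian (local_map p)) (chart p p).
Proof.
move=> sY; have dY := smooth_near_differentiable sY.
have dJ := differentiable_jacobian (smooth_local_map p).
rewrite (near_eq_derive _ (push_chart p Y)) (derive_mulmx _ dY dJ) /=.
by rewrite chartK ?to_chart_center //; exact: chart_dom_center.
Qed.

(** Both sides are the second derivative of [iota] in coordinates, applied to
    [u] and [v]. *)
Lemma hessian_sym p u v :
  u *m 'D_v (jacobian (local_map p)) (chart p p) =
  v *m 'D_u (jacobian (local_map p)) (chart p p).
Proof.
have sl := smooth_local_map p.
have dJ := differentiable_jacobian sl.
apply/rowP => k.
pose f z : R := local_map p z 0 k.
have df : \forall z \near chart p p, differentiable f z.
  by apply: filterS sl => z /smooth_differentiable /differentiable_mxP; apply.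
have dirJ w : \forall z \near chart p p, (w *m jacobian (local_map p) z) 0 k = 'D_w f z.
  apply: filterS sl => z /smooth_differentiable dl.
  by rewrite -(deriveEjacobian _ dl) derive_mx ?mxE //; exact: diff_derivable.
have dw (w : 'rV[R]_n) :
    differentiable (fun z => w *m jacobian (local_map p) z) (chart p p).
  exact: (differentiable_mulmx (differentiable_cst _ _) dJ).
have d2 w : differentiable ('D_w f) (chart p p).
  by apply: near_eq_differentiable (dirJ w) _; move/differentiable_mxP: (dw w); apply.
have E w w' : (w *m 'D_w' (jacobian (local_map p)) (chart p p)) 0 k =
    'D_w' ('D_w f) (chart p p).
  rewrite -(near_eq_derive _ (dirJ w)).
  have H := etrans (esym (derive_mulmxl w w' dJ))
    (derive_mx (diff_derivable (v := w') (dw w))).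
  by rewrite H mxE.
by apply: etrans (E u v) (etrans _ (esym (E v u))); exact: Schwarz_theorem.
Qed.

Variable nablabar : Mbar -> 'rV[R]_N -> (Mbar -> 'rV[R]_N) -> 'rV[R]_N.
Local Notation D := (deriv_along iota nablabar).

Lemma deriv_alongE p v W : D p v W = 'D_v (along_chart p W) (chart p p)
  + W p *m christoffel nablabar (iota p) (v *m diff_map iota p).
Proof.
rewrite /deriv_along [in RHS]mulmx_sum_row; congr (_ + _).
by apply: eq_bigr => j _; rewrite rowK.
Qed.

Lemma along_chartB p V W :
  along_chart p (fun r => V r - W r) = along_chart p V - along_chart p W.
Proof. by apply/funext => z; rewrite /along_chart /= /to_chart mulmxBl. Qed.

(** Differentiability is needed because the derivative of a sum of functions
    need not be the sum of derivatives without it. *)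
Lemma deriv_along_sub p v V W : differentiable_along p V -> differentiable_along p W ->
  D p v (fun r => V r - W r) = D p v V - D p v W.
Proof.
move=> dV dW; rewrite !deriv_alongE along_chartB deriveB; try exact: diff_derivable.
by rewrite mulmxBl opprD addrACA.
Qed.

End Immersions.

(** * The Gauss formula *)
Section Gauss.
Context {R : realType} {n N : nat} {M : manifold R n} {Mbar : manifold R N}.
Variable iota : M -> Mbar.
Hypothesis iota_smooth : smooth_map iota.
Variables (g : Mbar -> 'M[R]_N)
  (nablabar : Mbar -> 'rV[R]_N -> (Mbar -> 'rV[R]_N) -> 'rV[R]_N).
Hypotheses (g_metric : riemannian_metric g) (nablabar_lc : levi_civita g nablabar).
Implicit Types (p r : M) (X Y Z : M -> 'rV[R]_n) (V W : M -> 'rV[R]_N).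
Local Notation D := (deriv_along iota nablabar).

Lemma innerBl (q : Mbar) (u v w : 'rV[R]_N) :
  inner g q (u - v) w = inner g q u w - inner g q v w.
Proof. by rewrite /inner !mulmxBl !mxE. Qed.

Lemma chart_metric_center (q : Mbar) : chart_metric g q (chart q q) = g q.
Proof.
have qq := chart_dom_center q.
by rewrite /chart_metric /= chartK // trans_id // mul1mx trmx1 mulmx1.
Qed.

Lemma inner_chart (q s : Mbar) v w : chart_dom q s ->
  inner g s v w = (to_chart q s v *m (trans q s s *m g s *m (trans q s s)^T)
                   *m (to_chart q s w)^T) 0 0.
Proof.
move=> qs; rewrite -{1}(const_field_to_chart v qs) -{1}(const_field_to_chart w qs).
rewrite /inner /const_field; move: (to_chart q s v) (to_chart q s w) (trans q s s).
by move=> a b T; rewrite trmx_mul !mulmxA.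
Qed.

Lemma near_iota_chart p : \forall z \near chart p p,
  chart_dom (iota p) (iota (chart_inv p z)) /\
  chart_inv (iota p) (local_map iota p z) = iota (chart_inv p z).
Proof.
have C := near_at_center (near_iota iota_smooth (near_dom_center (iota p))).
by apply: filterS C => z qz; split => //; rewrite /local_map /= chartK.
Qed.

(** The product rule for the coordinate expression of the inner product; the
    chain rule reduces the derivative of the Gram matrix along [iota] to
    [derive_chart_metric], whose two terms complete the derivatives of the
    components into covariant ones. *)
Lemma deriv_along_metric p v V W :
  differentiable_along iota p V -> differentiable_along iota p W ->
  dir_deriv p v (fun r => inner g (iota r) (V r) (W r)) =
  inner g (iota p) (D p v V) (W p) + inner g (iota p) (V p) (D p v W).
Proof.
move=> dV dW; pose q := iota p; pose z0 := chart p p.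
pose Gl : 'rV[R]_n -> 'M[R]_N := chart_metric g q \o local_map iota p.
have dloc : differentiable (local_map iota p) z0.
  exact/smooth_differentiable/(nbhs_singleton (smooth_local_map iota_smooth p)).
have dG : differentiable (chart_metric g q) (local_map iota p z0).
  by rewrite local_map_center; exact: differentiable_chart_metric.
have dGl : differentiable Gl z0 by exact: differentiable_comp.
have DGl : 'D_v Gl z0 = christoffel nablabar q (v *m diff_map iota p) *m g q
     + g q *m (christoffel nablabar q (v *m diff_map iota p))^T.
  rewrite (derive_chain_jacobian _ dloc dG) local_map_center.
  exact: derive_chart_metric.
have Gl0 : Gl z0 = g q by rewrite /Gl /= local_map_center chart_metric_center.
pose F z := along_chart iota p V z *m Gl z *m (along_chart iota p W z)^T.
have E : \forall z \near z0,
    inner g (iota (chart_inv p z)) (V (chart_inv p z)) (W (chart_inv p z)) = F z 0 0.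
  apply: filterS (near_iota_chart p) => z [qz lz].
  by rewrite (inner_chart _ _ qz) /F /Gl /= /chart_metric /= lz.
have dWT := differentiable_trmx dW.
have dVG := differentiable_mulmx dV dGl.
rewrite /dir_deriv (near_eq_derive _ E).
have dF : differentiable F z0 by exact: differentiable_mulmx.
have -> : 'D_v (fun z => F z 0 0) z0 = ('D_v F z0) 0 0.
  by rewrite derive_mx ?mxE //; exact: diff_derivable.
rewrite (derive_mulmx _ dVG dWT) (derive_mulmx _ dV dGl) (derive_trmx _ dW) DGl Gl0.
rewrite !along_chart_center /inner !deriv_alongE.
have alg (a a' b b' : 'rV[R]_N) (C G : 'M[R]_N) :
    ((a' *m G + a *m (C *m G + G *m C^T)) *m b^T + a *m G *m b'^T) 0 0 =
    ((a' + a *m C) *m G *m b^T) 0 0 + (a *m G *m (b' + b *m C)^T) 0 0.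
  have add00 (x y : 'M[R]_1) : x 0 0 + y 0 0 = (x + y) 0 0 by rewrite mxE.
  rewrite add00 [(b' + _)^T]linearD /= trmx_mul !mulmxDl !mulmxDr !mulmxDl !mulmxA.
  congr (fun_of_matrix _ 0 0); rewrite -!addrA.
  by congr (_ + _); congr (_ + _); rewrite addrC.
exact: alg.
Qed.

(** In coordinates the difference contains the second derivatives of [iota] and
    the Christoffel terms, both symmetric in the two directions; what remains is
    the image of the bracket. *)
Lemma deriv_along_bracket p X Y : vf_smooth_near p X -> vf_smooth_near p Y ->
  D p (X p) (push iota Y) - D p (Y p) (push iota X) =
  (dir_deriv p (X p) (fun r => to_chart p r (Y r))
  - dir_deriv p (Y p) (fun r => to_chart p r (X r))) *m diff_map iota p.
Proof.
move=> sX sY; rewrite !deriv_alongE !dir_deriv_push // /push.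
rewrite (hessian_sym iota_smooth p (Y p)) (christoffel_sym nablabar_lc _ (Y p *m _)).
have cancel (a b h c : 'rV[R]_N) : a + h + c - (b + h + c) = a - b.
  by rewrite -(addrA a) -(addrA b) opprD addrACA subrr addr0.
by rewrite mulmxBl cancel.
Qed.

Variable nabla : M -> 'rV[R]_n -> (M -> 'rV[R]_n) -> 'rV[R]_n.
Hypothesis nabla_lc : levi_civita (induced_metric iota g) nabla.

Lemma inner_induced p (u v : 'rV[R]_n) : inner (induced_metric iota g) p u v =
  inner g (iota p) (u *m diff_map iota p) (v *m diff_map iota p).
Proof. by rewrite /inner /induced_metric trmx_mul !mulmxA. Qed.

(** Let [S X Y] be the difference of the ambient derivative of [Y] along [X] and
    of the image of [nabla_X Y].  It is symmetric, as both connections are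
    torsion-free, and [inner (S X Y) Z] is skew in [Y] and [Z], as both are
    metric.  A quantity symmetric in the first two of three arguments and skew
    in the last two vanishes, so [S X Y] is orthogonal to [M]. *)
Lemma gauss_formula p X Y : vf_smooth_near p X -> vf_smooth_near p Y ->
  (D p (X p) (push iota Y) - nabla p (X p) Y *m diff_map iota p)
    *m g (iota p) *m (diff_map iota p)^T = 0.
Proof.
move=> sX sY.
pose S A B := D p (A p) (push iota B) - nabla p (A p) B *m diff_map iota p.
pose T A B C := inner g (iota p) (S A B) (push iota C p).
have T_sym A B C : vf_smooth_near p A -> vf_smooth_near p B -> T A B C = T B A C.
  move=> sA sB; congr inner; apply/eqP; rewrite -subr_eq0 /S opprD opprK addrACA.
  rewrite deriv_along_bracket // -(lc_bracket nabla_lc) // mulmxBl.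
  by rewrite addrACA subrr addNr addr0.
have T_skew A B C : vf_smooth_near p A -> vf_smooth_near p B -> vf_smooth_near p C ->
    T A B C = - T A C B.
  move=> sA sB sC; apply/eqP; rewrite -addr_eq0 /T /S !innerBl addrACA.
  have := deriv_along_metric (A p) (differentiable_along_push iota_smooth sB)
     (differentiable_along_push iota_smooth sC).
  have := lc_metric nabla_lc (A p) sB sC.
  under eq_fun do rewrite inner_induced.
  move=> -> /eqP; rewrite eq_sym -subr_eq0 !inner_induced opprD.
  rewrite (Defs.metric_sym g_metric _ (push iota B p)).
  by rewrite (Defs.metric_sym g_metric _ (B p *m _)).
have T0 C : vf_smooth_near p C -> T X Y C = 0.
  (* Alternating the two symmetries six times returns to the same arguments with
     the opposite sign. *)
  move=> sC; have : T X Y C = - T X Y C.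
    rewrite {1}T_sym // T_skew // T_sym // T_skew // opprK T_sym // T_skew //.
  by move=> /eqP; rewrite -addr_eq0 -mulr2n mulrn_eq0 => /eqP.
apply/rowP => k; have := T0 _ (vf_smooth_const_field p (delta_mx 0 k)).
rewrite /T /inner /push const_field_center trmx_mul trmx_delta !mulmxA.
by rewrite -colE !mxE.
Qed.

End Gauss.

(** * Tangential parts in a chart *)
Section TangentialChart.
Context {R : realType} {n N : nat}.

Lemma invmx_congruence (C C' Q : 'M[R]_n) : C *m C' = 1%:M -> Q \in unitmx ->
  invmx (C *m Q *m C^T) = C'^T *m invmx Q *m C'.
Proof.
move=> CC' uQ; have [uC _] := mulmx1_unit CC'.
have CT : C^T *m C'^T = 1%:M by rewrite -trmx_mul (mulmx1C CC') trmx1.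
have uU : C *m Q *m C^T \in unitmx by rewrite !unitmx_mul unitmx_tr uC uQ.
suff H : C *m Q *m C^T *m (C'^T *m invmx Q *m C') = 1%:M.
  by rewrite -[RHS](mulKmx uU) H mulmx1.
rewrite !mulmxA -(mulmxA _ C^T) CT mulmx1 -(mulmxA C).
by rewrite mulmxV // mulmx1.
Qed.

(** The tangential projection of [phi Y], computed in given bases on the left
    and in coordinates on the right.  [C] and [B] change the components of
    vectors tangent to [M] and to the ambient manifold, [C'] and [T] are their
    inverses, and [A] is the coordinate expression of [D]. *)
Lemma tangential_chart (y : 'rV[R]_n) (C C' : 'M[R]_n) (A D : 'M[R]_(n, N))
    (T B phi g : 'M[R]_N) :
  C *m C' = 1%:M -> B *m T = 1%:M -> D *m B = C *m A ->
  D *m g *m D^T \in unitmx ->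
  y *m D *m phi *m g *m D^T *m invmx (D *m g *m D^T) *m D *m B =
  y *m C *m A *m (T *m phi *m B) *m (T *m g *m T^T) *m A^T
    *m invmx (A *m (T *m g *m T^T) *m A^T) *m A.
Proof.
move=> CC' BT DB; have C'C := mulmx1C CC'.
have -> : D = C *m A *m T by rewrite -DB -mulmxA BT mulmx1.
set G := T *m g *m T^T; set Q := A *m G *m A^T.
have -> : C *m A *m T *m g *m (C *m A *m T)^T = C *m Q *m C^T.
  by rewrite /Q /G !trmx_mul !mulmxA.
rewrite !unitmx_mul unitmx_tr => /andP[/andP[uC uQ] _].
rewrite (invmx_congruence CC' uQ) !trmx_mul !mulmxA.
have CT : C^T *m C'^T = 1%:M by rewrite -trmx_mul C'C trmx1.
rewrite -(mulmxA _ C^T) CT mulmx1.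
rewrite -(mulmxA _ C' C) C'C mulmx1 -(mulmxA _ T B) (mulmx1C BT) mulmx1.
by rewrite -(mulmxA _ B T) BT mulmx1.
Qed.

End TangentialChart.

(** * Submanifolds of Sasakian manifolds *)
Section SasakianSubmanifold.
Context {R : realType} {m n : nat} {Mbar : sasakian R m} {M : manifold R n}.
Variable iota : M -> Mbar.
Hypothesis iota_immersion : immersion iota.
Local Notation g := (@sas_g R m Mbar).
Local Notation phi := (@sas_phi R m Mbar).
Local Notation xi := (@sas_xi R m Mbar).
Local Notation eta := (@sas_eta R m Mbar).
Local Notation D := (deriv_along iota (@sas_nabla R m Mbar)).
Local Notation Dm := (diff_map iota).
Implicit Types (p r : M) (X Y : M -> 'rV[R]_n) (W : M -> 'rV[R]_((2 * m).+1)).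
Let iota_smooth : smooth_map iota := iota_immersion.1.

Lemma sas_g_pos (q : Mbar) (v : 'rV[R]_((2 * m).+1)) : v != 0 ->
  0 < (v *m g q *m v^T) 0 0.
Proof. exact: (metric_pos (sas_metric Mbar)). Qed.

Let free p : row_free (Dm p) := iota_immersion.2 p.

Lemma along_chart_phi p W : \forall z \near chart p p,
  along_chart iota p (fun r => W r *m phi (iota r)) z =
  along_chart iota p W z *m chart_phi (iota p) (local_map iota p z).
Proof.
apply: filterS (near_iota_chart iota_smooth p) => z [qz lz].
rewrite /chart_phi /= lz /along_chart /=.
rewrite -{1}(const_field_to_chart (W _) qz) /const_field.
move: (to_chart _ _ (W _)) => w.
rewrite /to_chart.
rewrite -[jacobian _ _]/(trans (iota (chart_inv p z)) (iota p) (iota (chart_inv p z))).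
by rewrite !mulmxA.
Qed.

Lemma differentiable_chart_phi_local p :
  differentiable (chart_phi (iota p) \o local_map iota p) (chart p p).
Proof.
apply: differentiable_comp.
  exact/smooth_differentiable/(nbhs_singleton (smooth_local_map iota_smooth p)).
by rewrite local_map_center; exact: differentiable_chart_phi.
Qed.

Lemma differentiable_along_phi p W : differentiable_along iota p W ->
  differentiable_along iota p (fun r => W r *m phi (iota r)).
Proof.
move=> dW; have := differentiable_mulmx dW (differentiable_chart_phi_local p).
apply: near_eq_differentiable.
by apply: filterS (along_chart_phi p W) => z ->.
Qed.

Lemma chart_phi_center (q : Mbar) : chart_phi q (chart q q) = phi q.
Proof.
have qq := chart_dom_center q.
by rewrite /chart_phi /= chartK // trans_id // mul1mx mulmx1.
Qed.

(** The Sasakian condition, carried over to fields along [iota] by the product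
    and chain rules. *)
Lemma deriv_along_phi p v W : differentiable_along iota p W ->
  D p v (fun r => W r *m phi (iota r)) = D p v W *m phi (iota p) +
  (inner g (iota p) (v *m Dm p) (W p) *: xi (iota p)
   - (W p *m eta (iota p)) 0 0 *: (v *m Dm p)).
Proof.
move=> dW; rewrite !deriv_alongE (near_eq_derive _ (along_chart_phi p W)).
have dl : differentiable (local_map iota p) (chart p p).
  exact/smooth_differentiable/(nbhs_singleton (smooth_local_map iota_smooth p)).
have dphi : differentiable (chart_phi (iota p)) (local_map iota p (chart p p)).
  by rewrite local_map_center; exact: differentiable_chart_phi.
have H := derive_mulmx v dW (differentiable_chart_phi_local p).
rewrite (derive_chain_jacobian _ dl dphi) along_chart_center /= local_map_center
  chart_phi_center in H.
rewrite -derive_chart_phi; apply: etrans (congr1 (+%R^~ _) H) _.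
have alg (a b c d : 'rV[R]_((2 * m).+1)) : a + b + c = a + d + (b + c - d).
  by rewrite -[in RHS]addrA [d + _]addrC subrK addrA.
by rewrite mulmxDl; exact: alg.
Qed.

Lemma op_P_coeff p v : op_P iota p v = v *m Dm p *m phi (iota p) *m g (iota p)
  *m (Dm p)^T *m invmx (Dm p *m g (iota p) *m (Dm p)^T).
Proof. exact: (tangent_coeffE (@sas_g_pos (iota p)) (free p)). Qed.

Lemma op_PF p v : v *m Dm p *m phi (iota p) = op_P iota p v *m Dm p + op_F iota p v.
Proof.
have := normal_projE (@sas_g_pos (iota p)) (free p) (v *m Dm p *m phi (iota p)).
rewrite op_P_coeff /op_F /nor_part /normal_space => ->.
by rewrite addrC subrK.
Qed.

(** In coordinates, the tangential part of [phi Y] is an expression in the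
    components of [Y], the Jacobian of [iota], the matrices of [phi] and [g] and
    the inverse of the Gram matrix of the immersion, all differentiable. *)
Lemma differentiable_along_op_P p Y : vf_smooth_near p Y ->
  differentiable_along iota p (push iota (fun r => op_P iota r (Y r))).
Proof.
move=> sY; have dY := smooth_near_differentiable sY.
have dJ := differentiable_jacobian (smooth_local_map iota_smooth p).
have dJT := differentiable_trmx dJ.
have dP := differentiable_chart_phi_local p.
have dl : differentiable (local_map iota p) (chart p p).
  exact/smooth_differentiable/(nbhs_singleton (smooth_local_map iota_smooth p)).
have dG : differentiable (chart_metric g (iota p) \o local_map iota p) (chart p p).
  apply: differentiable_comp dl _; rewrite local_map_center.
  exact: (differentiable_chart_metric (sas_metric Mbar)).
have dQ := differentiable_mulmx (differentiable_mulmx dJ dG) dJT.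
have uQ : jacobian (local_map iota p) (chart p p)
    *m chart_metric g (iota p) (local_map iota p (chart p p))
    *m (jacobian (local_map iota p) (chart p p))^T \in unitmx.
  rewrite local_map_center chart_metric_center.
  exact: (gram_unit (@sas_g_pos (iota p)) (free p)).
have := differentiable_mulmx (differentiable_mulmx (differentiable_mulmx
  (differentiable_mulmx (differentiable_mulmx (differentiable_mulmx dY dJ) dP) dG) dJT)
  (differentiable_invmx dQ uQ)) dJ.
apply: near_eq_differentiable.
have C1 := near_at_center (near_diff_map_chart iota_smooth p).
have C2 := near_chart_invK (chart_dom_center p).
have C3 := near_iota_chart iota_smooth p.
apply: filterS3 C1 C2 C3 => z [pz qz Dz] Kz [_ lz]; rewrite Kz in Dz.
rewrite /along_chart /= /push op_P_coeff /chart_metric /chart_phi /= lz /to_chart.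
have rr := chart_dom_center (chart_inv p z).
have ss := chart_dom_center (iota (chart_inv p z)).
have uD := gram_unit (@sas_g_pos (iota (chart_inv p z))) (free (chart_inv p z)).
have H := tangential_chart (Y (chart_inv p z)) (phi (iota (chart_inv p z)))
  (trans_inv rr pz) (trans_inv ss qz) Dz uD.
exact: esym H.
Qed.

Hypothesis xi_tangent : tangent_xi iota.
Variable nabla : M -> 'rV[R]_n -> (M -> 'rV[R]_n) -> 'rV[R]_n.
Hypothesis nabla_lc : levi_civita (induced_metric iota g) nabla.

Lemma nor_part_tangent p (v : 'rV[R]_n) : nor_part iota g p (v *m Dm p) = 0.
Proof. exact: (normal_proj_tangent (Dm p) (@sas_g_pos (iota p)) v). Qed.

(** By the Gauss formula, subtracting the tangential derivative leaves a normal
    vector, which its normal part therefore equals. *)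
Lemma second_formE p X Y : vf_smooth_near p X -> vf_smooth_near p Y ->
  second_form iota X Y p = D p (X p) (push iota Y) - nabla p (X p) Y *m Dm p.
Proof.
move=> sX sY; rewrite /second_form.
rewrite -[D p (X p) (push iota Y)](subrK (nabla p (X p) Y *m Dm p)).
rewrite /nor_part mulmxDl -!/(nor_part _ _ _ _) nor_part_tangent addr0 addrK.
apply: (normal_proj_normal (@sas_g_pos (iota p)) (free p)).
exact: (gauss_formula iota_smooth (sas_metric Mbar) (sas_levi_civita Mbar) nabla_lc).
Qed.

(** Split [phi Y] as [P Y + F Y] and differentiate.  The right-hand side of the
    Sasakian condition is a combination of [xi] and of the direction, hence
    tangent; the normal parts of the other terms are those of the formula. *)
Lemma nabla_FE X Y p : vf_smooth_near p X -> vf_smooth_near p Y ->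
  nabla_F iota nabla X Y p = op_f iota p (second_form iota X Y p)
    - second_form iota X (fun r => op_P iota r (Y r)) p.
Proof.
move=> sX sY; rewrite /nabla_F /normal_conn.
have -> : (fun r => op_F iota r (Y r)) = (fun r => push iota Y r *m phi (iota r)
    - push iota (fun r => op_P iota r (Y r)) r).
  by apply/funext => r; rewrite /push op_PF addrC addKr.
have dY := differentiable_along_push iota_smooth sY.
rewrite deriv_along_sub; last 2 first.
- exact: differentiable_along_phi.
- exact: differentiable_along_op_P.
rewrite (deriv_along_phi _ dY).
have [u Eu] := submxP (xi_tangent p).
have -> : D p (X p) (push iota Y)
    = nabla p (X p) Y *m Dm p + second_form iota X Y p.
  by rewrite second_formE // addrC subrK.
set a := inner _ _ _ _; set b := (_ *m eta _) 0 0.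
have -> : a *: xi (iota p) - b *: (X p *m Dm p) = (a *: u - b *: X p) *m Dm p.
  by rewrite Eu mulmxBl !scalemxAl.
have norD v w : nor_part iota g p (v + w) = nor_part iota g p v + nor_part iota g p w.
  exact: mulmxDl.
have norB v w : nor_part iota g p (v - w) = nor_part iota g p v - nor_part iota g p w.
  exact: mulmxBl.
rewrite norB norD nor_part_tangent addr0 mulmxDl norD addrAC.
by rewrite -/(op_F iota p _) [op_F _ _ _ + _]addrC addrK.
Qed.

End SasakianSubmanifold.

Theorem lemma6p1 (R : realType) (m n : nat) (Mbar : sasakian R m)
    (M : manifold R n) (iota : M -> Mbar)
    (nabla : M -> 'rV[R]_n -> (M -> 'rV[R]_n) -> 'rV[R]_n)
    (iota_immersion : immersion iota)
    (xi_tangent : tangent_xi iota)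
    (nabla_lc : levi_civita (induced_metric iota (@sas_g R m Mbar)) nabla) :
  (forall X Y : M -> 'rV[R]_n, smooth_vf X -> smooth_vf Y -> forall p : M,
     nabla_F iota nabla X Y p
       = op_f iota p (second_form iota X Y p)
         - second_form iota X (fun r => op_P iota r (Y r)) p)
  /\
  (F_parallel iota nabla <->
   forall X Y : M -> 'rV[R]_n, smooth_vf X -> smooth_vf Y -> forall p : M,
     second_form iota X (fun r => op_P iota r (Y r)) p
       = op_f iota p (second_form iota X Y p)).
Proof.
have E X Y : smooth_vf X -> smooth_vf Y -> forall p, nabla_F iota nabla X Y p
    = op_f iota p (second_form iota X Y p)
      - second_form iota X (fun r => op_P iota r (Y r)) p.
  by move=> sX sY p; exact: nabla_FE.
split=> [|//]; first exact: E.
split=> H X Y sX sY p; have := H X Y sX sY p.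
  by rewrite E // => /subr0_eq.
by rewrite E // => ->; rewrite subrr.
Qed.
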